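(* Let $R$ be a left and right principal ideal ring, and let $V$ be a left module over $R$. Assume that the ring $R$ contains a central regular element $r\in R$ such that $r-1$ is regular too. Let $a,b\in R$, with $b$ regular, be left coprime. Let $m=ab_1=ba_1$ (with $a_1,b_1\in R$) be their right least common multiple. Then, for every $x,y\in V$ such that $ax=by$, there exists $z\in V$ such that $x=b_1z$ and $y=a_1z$. In particular, $aV\cap bV=mV$.
   Context: Rings are unital and associative, not necessarily commutative. $R$ is a left and right principal ideal ring if every left ideal of $R$ has the form $Ra$ and every right ideal of $R$ has the form $aR$ for some $a\in R$. An element $k\in R$ is a right (resp. left) zero divisor if there exists $k_1\in R\setminus\{0\}$ such that $k_1k=0$ (resp. $kk_1=0$). A non-zero element of $R$ is regular if it is neither a left nor a right zero divisor. Elements $a,b\in R$ are left coprime if $aR+bR=R$. The right least common multiple of $a$ and $b$ is an element $m\in R$, defined up to multiplication by an invertible element, that generates the right ideal $aR\cap bR$, i.e. $mR=aR\cap bR$. For $c\in R$, $cV=\{cv\mid v\in V\}$.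
   Formalization: The existence of z is shown when every s with as=0 lies in b_1R (automatic if a is not a left zero divisor; for a=0, b=1, a_1=b_1=0 the claim fails); such a_1, b_1 are shown to exist for some right least common multiple, and aV∩bV=mV is shown without this condition. *)

(* Defs.v *)
From HB Require Import structures.
From mathcomp Require Import all_boot all_algebra.

Set Implicit Arguments.
Unset Strict Implicit.
Unset Printing Implicit Defensive.

Import GRing.Theory.
Local Open Scope ring_scope.

(* Rings are unital, associative and possibly noncommutative.  Subsets of a
   ring or module, in particular ideals, are arbitrary Prop-valued predicates,
   and their equality is pointwise equivalence. *)

Definition left_ideal (R : pzRingType) (I : R -> Prop) : Prop :=
  [/\ I 0, forall x y, I x -> I y -> I (x + y) & forall c x, I x -> I (c * x)].

Definition right_ideal (R : pzRingType) (I : R -> Prop) : Prop :=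
  [/\ I 0, forall x y, I x -> I y -> I (x + y) & forall c x, I x -> I (x * c)].

(* R a *)
Definition lprincipal (R : pzRingType) (a : R) : R -> Prop :=
  fun x => exists c, x = c * a.

(* a R *)
Definition rprincipal (R : pzRingType) (a : R) : R -> Prop :=
  fun x => exists c, x = a * c.

(* a V *)
Definition scale_image (R : pzRingType) (V : lmodType R) (a : R) : V -> Prop :=
  fun w => exists v : V, w = a *: v.
Arguments scale_image {R} V a _.

Definition left_right_pir (R : pzRingType) : Prop :=
  (forall I : R -> Prop, left_ideal I ->
     exists a, forall x, I x <-> lprincipal a x) /\
  (forall I : R -> Prop, right_ideal I ->
     exists a, forall x, I x <-> rprincipal a x).

Definition right_zero_divisor (R : pzRingType) (k : R) : Prop :=
  exists k1, k1 <> 0 /\ k1 * k = 0.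

Definition left_zero_divisor (R : pzRingType) (k : R) : Prop :=
  exists k1, k1 <> 0 /\ k * k1 = 0.

Definition regular (R : pzRingType) (k : R) : Prop :=
  [/\ k <> 0, ~ left_zero_divisor k & ~ right_zero_divisor k].

Definition central (R : pzRingType) (k : R) : Prop := forall c, k * c = c * k.

(* a R + b R = R *)
Definition left_coprime (R : pzRingType) (a b : R) : Prop :=
  forall c, exists s t, [/\ rprincipal a s, rprincipal b t & c = s + t].

(* m R = a R :&: b R *)
Definition right_lcm (R : pzRingType) (a b m : R) : Prop :=
  forall x, rprincipal m x <-> rprincipal a x /\ rprincipal b x.

(* The right annihilator of a is contained in b1 R.  When a is not a left zero
   divisor this holds for every b1, and a b1 = m determines b1.  When a is a
   left zero divisor, b1 is determined by a b1 = m only up to the right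
   annihilator of a, and an arbitrary choice is not good enough: with
   a = 0, b = 1, m = 0 one could take b1 = a1 = 0, and then x = b1 z fails for
   every x <> 0 although a x = b 0. *)
Definition absorbs_rann (R : pzRingType) (a b1 : R) : Prop :=
  forall s, a * s = 0 -> rprincipal b1 s.

(* Main.v *)
Require Import Defs.
From HB Require Import structures.
From mathcomp Require Import all_boot all_algebra.

Set Implicit Arguments.
Unset Strict Implicit.
Unset Printing Implicit Defensive.

Import GRing.Theory.
Local Open Scope ring_scope.

(** Choose [u], [v] with [a u + b v = 1]. The relation [a s = b t] is then
    satisfied in [R] by the two pairs [(1 - u a, v a)] and [(u b, 1 - v b)],
    the columns of the projection of [R^2] onto the kernel of
    [(s, t) |-> a s - b t]. A solution [(x, y)] in [V] equals
    [(1 - u a, v a) x + (u b, 1 - v b) y], so it is enough to know the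
    solutions in [R], and these are the right multiples of [(b1, a1)].
    The lcm with a good cofactor comes from a generator of the right ideal
    [{s | a s \in b R}]. *)

Lemma regular_lreg (R : pzRingType) (b : R) : regular b -> GRing.lreg b.
Proof.
move=> [_ b_nlzd _] s t eq_bst; apply/subr0_eq/eqP/negPn/negP => /eqP st_neq0.
by apply: b_nlzd; exists (s - t); split; rewrite // mulrBr eq_bst subrr.
Qed.

Section Bezout.

Variables (R : pzRingType) (a b u v : R).
Hypothesis bezout : 1 = a * u + b * v.

Lemma bezout_syzygyl : a * (1 - u * a) = b * (v * a).
Proof. by rewrite mulrBr mulr1 !mulrA -{1}[a]mul1r bezout mulrDl addrC addKr. Qed.

Lemma bezout_syzygyr : a * (u * b) = b * (1 - v * b).
Proof. by rewrite mulrBr mulr1 !mulrA -{2}[b]mul1r bezout mulrDl addrK. Qed.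

Variables (V : lmodType R) (x y : V).
Hypothesis ax_by : a *: x = b *: y.

Lemma bezout_solutionl : x = (1 - u * a) *: x + (u * b) *: y.
Proof. by rewrite scalerBl scale1r -!scalerA ax_by subrK. Qed.

Lemma bezout_solutionr : y = (v * a) *: x + (1 - v * b) *: y.
Proof. by rewrite scalerBl scale1r -!scalerA ax_by subrKC. Qed.

End Bezout.

Lemma left_coprime_bezout (R : pzRingType) (a b : R) :
  left_coprime a b -> exists u v, 1 = a * u + b * v.
Proof. by case/(_ 1) => _ [_ [[u ->] [v ->] ->]]; exists u, v. Qed.

Lemma right_lcm_common (R : pzRingType) (a b m s t : R) :
  right_lcm a b m -> a * s = b * t -> rprincipal m (a * s).
Proof. by move=> m_lcm as_bt; apply/m_lcm; split; [exists s | exists t]. Qed.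

(** As [a * s] lies in the right ideal generated by [a * b1], [s] agrees with some [b1 * q] up to an
    element killed by [a], and [b1] absorbs that element. Cancelling [b] on the left then yields
    [t]. *)
Lemma right_lcm_cofactors (R : pzRingType) (a b a1 b1 s t : R) :
    GRing.lreg b -> right_lcm a b (a * b1) -> a * b1 = b * a1 ->
    absorbs_rann a b1 -> a * s = b * t ->
  exists p, s = b1 * p /\ t = a1 * p.
Proof.
move=> b_lreg m_lcm ab1_ba1 rann_b1 as_bt.
have [q def_as] := right_lcm_common m_lcm as_bt.
have [|d def_d] := rann_b1 (s - b1 * q); first by rewrite mulrBr def_as mulrA subrr.
have def_s : s = b1 * (q + d) by rewrite mulrDr -def_d subrKC.
by exists (q + d); split=> //; apply: b_lreg; rewrite -as_bt def_s !mulrA ab1_ba1.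
Qed.

Lemma right_lcm_absorbing (R : pzRingType) (a b : R) :
    left_right_pir R ->
  exists m a1 b1,
    [/\ right_lcm a b m, m = a * b1, m = b * a1 & absorbs_rann a b1].
Proof.
move=> [_ R_rpir]; have [] := R_rpir (fun s => rprincipal b (a * s)).
  split=> [|s t [p def_p] [q def_q]|c s [p def_p]].
  - by exists 0; rewrite !mulr0.
  - by exists (p + q); rewrite !mulrDr def_p def_q.
  - by exists (p * c); rewrite !mulrA def_p.
move=> b1 gen_b1.
have [a1 ab1_ba1] : rprincipal b (a * b1) by apply/gen_b1; exists 1; rewrite mulr1.
exists (a * b1), a1, b1; split=> // [w|s as0]; last first.
  (* The right annihilator of [a] lies in the ideal generated by [b1], because 0 is a right multiple
     of [b]. *)
  by apply/gen_b1; exists 0; rewrite as0 mulr0.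
split=> [[c ->]|[[s ->] /gen_b1[c ->]]]; last by exists c; rewrite mulrA.
by split; [exists (b1 * c) | exists (a1 * c)]; rewrite ?ab1_ba1 mulrA // ab1_ba1.
Qed.

(** Multiplying the decomposition of [x] by [a] gives it the coefficients [a * (1 - u * a)] and
    [a * (u * b)]; by the syzygies both are common right multiples of [a] and [b], hence right
    multiples of [m]. *)
Lemma scale_image_right_lcm (R : pzRingType) (V : lmodType R) (a b m : R) :
    left_coprime a b -> right_lcm a b m ->
  forall w : V, scale_image V a w /\ scale_image V b w <-> scale_image V m w.
Proof.
move=> /left_coprime_bezout[u [v bezout]] m_lcm w; split=> [[[x ->] [y ax_by]]|].
  have [p def_p] := right_lcm_common m_lcm (bezout_syzygyl bezout).
  have [q def_q] := right_lcm_common m_lcm (bezout_syzygyr bezout).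
  exists (p *: x + q *: y).
  by rewrite {1}(bezout_solutionl u ax_by) !scalerDr !scalerA def_p def_q.
case=> z ->; have [[s def_as] [t def_bt]] : rprincipal a m /\ rprincipal b m.
  by apply/m_lcm; exists 1; rewrite mulr1.
split; first by exists (s *: z); rewrite scalerA -def_as.
by exists (t *: z); rewrite scalerA -def_bt.
Qed.

(** The equation [m = a * b1] fixes [b1] only modulo the right annihilator of [a], hence the guard
    on the first conjunct; the last one provides cofactors that satisfy it. *)
Theorem theorem3p3 (R : pzRingType) (V : lmodType R)
    (R_pir : left_right_pir R)
    (r : R) (r_central : central r) (r_reg : regular r)
    (r1_reg : regular (r - 1))
    (a b : R) (b_reg : regular b) (ab_coprime : left_coprime a b)
    (m a1 b1 : R) (m_lcm : right_lcm a b m)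
    (m_ab1 : m = a * b1) (m_ba1 : m = b * a1) :
  [/\ absorbs_rann a b1 ->
        forall x y : V, a *: x = b *: y ->
          exists z : V, x = b1 *: z /\ y = a1 *: z,
      forall w : V,
        scale_image V a w /\ scale_image V b w <-> scale_image V m w
    & exists m' a1' b1' : R,
        [/\ right_lcm a b m', m' = a * b1', m' = b * a1' & absorbs_rann a b1']].
Proof.
split; [|exact: scale_image_right_lcm|exact: right_lcm_absorbing].
move=> rann_b1 x y ax_by; have b_lreg := regular_lreg b_reg.
have [u [v bezout]] := left_coprime_bezout ab_coprime.
have ab1_ba1 : a * b1 = b * a1 by rewrite -m_ab1.
rewrite m_ab1 in m_lcm.
have cofactors s t := @right_lcm_cofactors _ a b a1 b1 s t b_lreg m_lcm ab1_ba1 rann_b1.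
have [p [def_pl def_pr]] := cofactors _ _ (bezout_syzygyl bezout).
have [q [def_ql def_qr]] := cofactors _ _ (bezout_syzygyr bezout).
(* The two syzygies are [(b1, a1)] times [p] and [q], so [b1] and [a1] send this witness to the
   decompositions of [x] and [y]. *)
exists (p *: x + q *: y); rewrite !scalerDr !scalerA -def_pl -def_pr -def_ql -def_qr.
by split; [exact: bezout_solutionl | exact: bezout_solutionr].
Qed.
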